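(* Let $d_0,d\in\mathbb N$ with $d_0<d$. Let $\mathsf Q$ be a self-adjoint invertible $2d\times2d$ matrix with $d$ positive and $d$ negative eigenvalues. Let $\mathcal P(z)$ be a $d\times2d$ matrix polynomial of degree $p\in\mathbb N$; for $j\in\{1,\dots,d\}$ let $\mu_j\in\{0\}\cup\mathbb N$ be the degree of its $j$-th row, and assume that $\mathcal P(z)\in\mathbb P_{\mathsf Q}$ with $$p=\mu_1\ge\cdots\ge\mu_{d_0}>\mu_{d_0+1}=\cdots=\mu_d=0.$$ Let $\mathsf B$ be the $(d-d_0)\times2d$ constant matrix consisting of the bottom $d-d_0$ rows of $\mathcal P(z)$. Then there exist a unimodular $d\times d$ matrix polynomial $\mathcal W(z)$, a $d_0\times2d_0$ matrix polynomial $\widehat{\mathcal P}(z)$, and a $2d_0\times2d$ matrix $\mathsf B_0$ such that $$\mathcal W(z)\mathcal P(z)=\begin{bmatrix}\widehat{\mathcal P}(z)&\mathsf 0\\\mathsf 0&\mathsf I_{d-d_0}\end{bmatrix}\begin{bmatrix}\mathsf B_0\\\mathsf B\end{bmatrix},$$ and (i) the $(d+d_0)\times2d$ matrix $\begin{bmatrix}\mathsf B_0\\\mathsf B\end{bmatrix}$ has full rank $d+d_0$; (ii) $\mathsf B\mathsf Q^{-1}\mathsf B^*=\mathsf 0$ and $\mathsf B_0\mathsf Q^{-1}\mathsf B^*=\mathsf 0$; (iii) $\mathsf B_0\mathsf Q^{-1}\mathsf B_0^*$ is invertible with $d_0$ positive and $d_0$ negative eigenvalues; (iv) $\widehat{\mathcal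 P}(z)\mathsf Q_0^{-1}\widehat{\mathcal P}(z^* )^*=\mathsf 0$ for all $z\in\mathbb C$, where $\mathsf Q_0=(\mathsf B_0\mathsf Q^{-1}\mathsf B_0^* )^{-1}$; (v) $\operatorname{rank}\widehat{\mathcal P}(z)=d_0$ for all $z\in\mathbb C$; (vi) $\operatorname{rank}\widehat{\mathsf P}_\infty=d_0$, where $\widehat{\mathsf P}_\infty=\lim_{z\to\infty}\operatorname{diag}(z^{-\mu_1},\dots,z^{-\mu_{d_0}})\widehat{\mathcal P}(z)$; (vii) for $j\in\{1,\dots,d_0\}$ the degree of the $j$-th row of $\widehat{\mathcal P}(z)$ equals $\mu_j$, so that $p=\mu_1\ge\cdots\ge\mu_{d_0}\ge1$.
   Context: $\mathbb N=\{1,2,\dots\}$; $z^*$ is the complex conjugate of $z\in\mathbb C$, and $^*$ on a matrix is the conjugate transpose. The degree of a (row, matrix) polynomial is the highest power of $z$ with nonzero coefficient ($-\infty$ for the zero polynomial). A square matrix polynomial is unimodular if its determinant is a nonzero constant. $\mathbb P_{\mathsf Q}$ is the set of $d\times2d$ matrix polynomials $\mathcal P(z)$ with row degrees $\mu_1,\dots,\mu_d$ such that: (a) $\mathcal P(z)\mathsf Q^{-1}\mathcal P(z^* )^*=\mathsf 0$ for all $z\in\mathbb C$; (b) $\operatorname{rank}\mathcal P(z)=d$ for all $z\in\mathbb C$; (c) $\operatorname{rank}\mathsf P_\infty=d$, where $\mathsf P_\infty=\lim_{z\to\infty}\operatorname{diag}(z^{-\mu_1},\dots,z^{-\mu_d})\mathcal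 P(z)$ is the matrix of leading row coefficients; (d) $\mu_1\ge\cdots\ge\mu_d\ge0$. *)

(* Defs.v *)
From HB Require Import structures.
From mathcomp Require Export all_boot all_order all_algebra sesquilinear spectral.
From mathcomp Require Export complex.
From mathcomp Require Export boolp classical_sets filter reals topology normedtype.

Set Implicit Arguments.
Unset Strict Implicit.
Unset Printing Implicit Defensive.

Import Order.TTheory GRing.Theory Num.Theory.
Import numFieldNormedType.Exports.

Local Open Scope classical_set_scope.
Local Open Scope complex_scope.
Local Open Scope ring_scope.
Local Open Scope sesquilinear_scope.

(* The filter of neighbourhoods of the point at infinity of the complex plane:
   z --> oo means that the modulus of z tends to +oo. *)
Definition complex_infty (R : realType) : set_system R[i] :=
  filter_from [set: R] (fun M : R => [set z : R[i] | M%:C < `|z|]).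
Arguments complex_infty : clear implicits.

Definition mxeval (R : realType) m n (P : 'M[{poly R[i]}]_(m, n)) (z : R[i]) :
  'M[R[i]]_(m, n) := map_mx (horner_eval z) P.

(* size q is 1 + deg q for q != 0, and 0 for q = 0: the largest size of the
   entries is k.+1 iff the highest power of the variable with a nonzero
   coefficient is the k-th one. A zero row (degree -oo) has no degree k. *)
Definition row_has_degree (R : realType) m n (P : 'M[{poly R[i]}]_(m, n))
  (i : 'I_m) (k : nat) : Prop := (\max_(j < n) size (P i j) = k.+1)%N.

Definition mx_has_degree (R : realType) m n (P : 'M[{poly R[i]}]_(m, n))
  (k : nat) : Prop := (\max_(i < m) \max_(j < n) size (P i j) = k.+1)%N.

Definition unimodular (R : realType) n (W : 'M[{poly R[i]}]_n) : Prop :=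
  exists2 c : R[i], c != 0 & \det W = c%:P.

(* Roots of the characteristic polynomial, with algebraic multiplicity. *)
Definition eigenvalues (R : realType) n (A : 'M[R[i]]_n) : seq R[i] :=
  sval (closed_field_poly_normal (char_poly A)).

(* In the partial order of R[i], 0 < x says that x is real and positive. *)
Definition num_pos_eigenvalues (R : realType) n (A : 'M[R[i]]_n) : nat :=
  count (fun x : R[i] => 0 < x) (eigenvalues A).

Definition num_neg_eigenvalues (R : realType) n (A : 'M[R[i]]_n) : nat :=
  count (fun x : R[i] => x < 0) (eigenvalues A).

(* The regular module R[i]^o carries the topology given by the modulus. *)
Definition row_scaled_limit (R : realType) m n (mu : 'I_m -> nat)
    (P : 'M[{poly R[i]}]_(m, n)) (L : 'M[R[i]]_(m, n)) : Prop :=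
  diag_mx (\row_i z ^- mu i) *m mxeval P z @[z --> complex_infty R]
    --> (L : 'M[R[i]^o]_(m, n)).

Definition PQ (R : realType) d (Q : 'M[R[i]]_(2 * d))
    (P : 'M[{poly R[i]}]_(d, 2 * d)) : Prop :=
  exists mu : 'I_d -> nat,
  [/\ forall i, row_has_degree P i (mu i),
      forall z : R[i],
        mxeval P z *m invmx Q *m (mxeval P (z^*)%R)^t* = 0,
      forall z : R[i], \rank (mxeval P z) = d,
      exists2 Pinf : 'M[R[i]]_(d, 2 * d),
        row_scaled_limit mu P Pinf & \rank Pinf = d
    & forall i j : 'I_d, (i <= j)%N -> (mu j <= mu i)%N].

Definition bottom_rows (T : Type) d0 d n (le_d0d : (d0 <= d)%N)
    (A : 'M[T]_(d, n)) : 'M[T]_(d - d0, n) :=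
  dsubmx (castmx (esym (subnKC le_d0d), erefl n) A).

(* Main.v *)
(* Put [J = Q^-1].  Since the rows of [B] are rows of every [P(z)], they span a
   [J]-isotropic space contained in its orthogonal [V], and all rows of [P(z)]
   lie in [V].  Completing [B] by [B0] to a basis of [V], the form induced on
   [V / B] has Gram matrix [B0 J B0^*]; it is nondegenerate because the
   orthogonal of [V] is the row space of [B].  A positive space for it, together
   with [B], is nonnegative for [J], hence has dimension at most [d]; the same
   holds for a negative space, which forces the signature [(d0, d0)].

   The upper rows [T] of [P] decompose uniquely as [T = Phat B0 + D B] with
   polynomial [Phat], [D], and [W] subtracts [D B].  As [B0], [B] are constant,
   extracting row coefficients commutes with the decomposition, so that [Phat]
   inherits the row degrees and the rank conditions of [T] modulo [B]. *)
Require Import Defs.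
From mathcomp Require Import zify.

Set Implicit Arguments.
Unset Strict Implicit.
Unset Printing Implicit Defensive.

Import Order.TTheory GRing.Theory Num.Theory.
Import numFieldNormedType.Exports.

Local Open Scope complex_scope.
Local Open Scope ring_scope.
Local Open Scope sesquilinear_scope.

(** * Eigenvalue counts and definite subspaces of Hermitian forms *)

Lemma char_poly_conj (F : fieldType) n (U A : 'M[F]_n) :
  U \in unitmx -> char_poly (invmx U *m A *m U) = char_poly A.
Proof.
move=> Uu; rewrite /char_poly.
have UVU : map_mx polyC (invmx U) *m map_mx polyC U = 1%:M.
  by rewrite -map_mxM mulVmx // map_mx1.
suff -> : char_poly_mx (invmx U *m A *m U) =
    map_mx polyC (invmx U) *m char_poly_mx A *m map_mx polyC U.
  by rewrite !det_mulmx mulrAC -det_mulmx UVU det1 mul1r.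
rewrite /char_poly_mx !map_mxM mulmxBr mulmxBl; congr (_ - _).
by rewrite scalar_mxC -mulmxA UVU mulmx1.
Qed.

Section Inertia.
Variable R : realType.
Local Notation C := R[i].

Definition herm_form n (A : 'M[C]_n) (v : 'rV_n) : C := (v *m A *m v^t* ) 0 0.

Lemma adj_mul m n p (A : 'M[C]_(m, n)) (B : 'M_(n, p)) :
  (A *m B)^t* = B^t* *m A^t*.
Proof. by rewrite trmx_mul map_mxM. Qed.

Lemma herm_form_mull m n (A : 'M[C]_n) (S : 'M_(m, n)) (x : 'rV_m) :
  herm_form A (x *m S) = herm_form (S *m A *m S^t* ) x.
Proof. by rewrite /herm_form adj_mul !mulmxA. Qed.

Lemma herm_formN n (A : 'M[C]_n) (v : 'rV_n) :
  herm_form A (- v) = herm_form A v.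
Proof. by rewrite /herm_form linearN map_mxN mulmxN !mulNmx opprK. Qed.

Lemma herm_formNmx n (A : 'M[C]_n) (v : 'rV_n) :
  herm_form (- A) v = - herm_form A v.
Proof. by rewrite /herm_form mulmxN mulNmx mxE. Qed.

Lemma herm_form_diag n (D : 'rV[C]_n) (v : 'rV_n) :
  herm_form (diag_mx D) v = \sum_i D 0 i * `|v 0 i| ^+ 2.
Proof.
rewrite /herm_form mul_mx_diag mxE; apply: eq_bigr => i _.
by rewrite !mxE normCK [v 0 i * _]mulrC mulrA.
Qed.

Lemma hermP n (A : 'M[C]_n) : reflect (A^t* = A) (A \is hermsymmx).
Proof.
by rewrite is_hermitianmxE expr0 scale1r eq_sym; apply: eqP.
Qed.

(** The characteristic polynomial is invariant under the unitary diagonalization, and its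
    factorization into monic linear factors is unique up to order; this ties [eigenvalues] to the
    spectral diagonal. *)
Lemma herm_spectral n (A : 'M[C]_n) : A \is hermsymmx ->
  exists U (D : 'rV_n), [/\ U \is unitarymx, D \is a realmx,
    A = U^t* *m diag_mx D *m U &
    perm_eq (eigenvalues A) [seq D 0 i | i <- enum 'I_n]].
Proof.
move=> Ah; have U := spectral_unitarymx A.
have AE : A = invmx (spectralmx A) *m diag_mx (spectral_diag A) *m spectralmx A.
  exact/orthomx_spectralP/hermitian_normalmx.
exists (spectralmx A), (spectral_diag A); split=> //.
- exact: hermitian_spectral_diag_real.
- by rewrite -invmx_unitary.
apply: prod_XsubC_eq; rewrite /eigenvalues.
case: closed_field_poly_normal => /= s; rewrite (monicP (char_poly_monic A)).
rewrite scale1r => <-; rewrite [in LHS]AE char_poly_conj ?spectral_unit //.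
rewrite char_poly_trig ?diag_mx_is_trig // big_map big_enum /=.
by apply: eq_bigr => i _; rewrite mxE eqxx.
Qed.

(** The rows of [S] are the orthonormal eigenvectors whose eigenvalue satisfies [c]. This turns a
    count of eigenvalues into a space of that dimension on which the form is diagonal. *)
Lemma herm_compression n (A : 'M[C]_n) (c : pred C) : A \is hermsymmx ->
  exists (S : 'M_(count c (eigenvalues A), n)) (D : 'rV_(_)),
    (forall i, c (D 0 i)) /\ S *m A *m S^t* = diag_mx D.
Proof.
move=> /herm_spectral [U [D [Uu _ AE /permP ->]]].
have -> : count c [seq D 0 i | i <- enum 'I_n] = #|[pred i | c (D 0 i)]|.
  by rewrite count_map -size_filter cardE enumT /enum_mem.
pose f := @enum_val _ [pred i | c (D 0 i)].
exists (rowsub f U), (\row_i D 0 (f i)); split=> [i|].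
  by rewrite mxE; have := enum_valP i; rewrite inE.
have UUt : U *m U^t* = 1%:M by apply/unitarymxP.
rewrite AE rowsubE adj_mul !mulmxA -(mulmxA _ U) UUt mulmx1.
rewrite -(mulmxA _ U) UUt mulmx1 -rowsubE.
have -> : (rowsub f 1%:M)^t* = colsub f 1%:M :> 'M[C]__.
  by apply/matrixP => i j; rewrite !mxE eq_sym rmorph_nat.
rewrite mulmx_colsub mulmx1; apply/matrixP => i j.
by rewrite !mxE (inj_eq enum_val_inj).
Qed.

Lemma sum_scaled_norm_ge0 n (D v : 'rV[C]_n) :
  (forall i, 0 < D 0 i) -> 0 <= \sum_i D 0 i * `|v 0 i| ^+ 2.
Proof.
by move=> D0; apply: sumr_ge0 => i _; rewrite mulr_ge0 ?exprn_ge0 // ltW.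
Qed.

Lemma sum_scaled_norm_eq0 n (D v : 'rV[C]_n) :
  (forall i, 0 < D 0 i) -> \sum_i D 0 i * `|v 0 i| ^+ 2 = 0 -> v = 0.
Proof.
move=> D0 /psumr_eq0P => /(_ _) h; apply/rowP => i; rewrite mxE.
have /eqP : D 0 i * `|v 0 i| ^+ 2 = 0.
  by apply: h => // j _; rewrite mulr_ge0 ?exprn_ge0 // ltW.
by rewrite mulf_eq0 gt_eqF //= expf_eq0 normr_eq0 => /eqP.
Qed.

(* The spans of [X] and [Y] meet trivially, since the form has opposite signs
   on them. *)
Lemma nonneg_neg_dim m1 m2 n (A : 'M[C]_n) (X : 'M_(m1, n)) (Y : 'M_(m2, n)) :
  row_free X -> (forall x, 0 <= herm_form A (x *m X)) ->
  (forall y, y != 0 -> herm_form A (y *m Y) < 0) -> (m1 + m2 <= n)%N.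
Proof.
move=> Xfree Xge0 Ylt0.
suff /eqP <- : row_free (col_mx X Y) by exact: rank_leq_col.
apply: inj_row_free => v; rewrite -(hsubmxK v) mul_row_col.
move/eqP; rewrite addr_eq0 => /eqP xyE.
have y0 : rsubmx v = 0.
  apply/eqP; apply: contraT => /Ylt0; rewrite -herm_formN -xyE.
  by rewrite le_gtF.
have x0 : lsubmx v = 0.
  by apply: (row_free_inj Xfree); rewrite xyE y0 !mul0mx oppr0.
by rewrite x0 y0 row_mx0.
Qed.

Lemma invmx_herm n (A : 'M[C]_n) : A \is hermsymmx -> A \in unitmx ->
  invmx A \is hermsymmx.
Proof.
by move=> /hermP AE Au; apply/hermP; rewrite trmx_inv map_invmx /= AE.
Qed.

(** The eigenvalues are real, and invertibility makes them nonzero, so failing to be positive means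
    being negative. *)
Lemma num_eigenvalues_unit n (A : 'M[C]_n) : A \is hermsymmx ->
  A \in unitmx -> (num_pos_eigenvalues A + num_neg_eigenvalues A = n)%N.
Proof.
move=> Ah Au; have [U [D [Uu Dreal AE eigE]]] := herm_spectral Ah.
have D0 i : D 0 i != 0.
  move: Au; rewrite AE !unitmx_mul => /andP[/andP[_]].
  rewrite unitmxE det_diag unitfE => /prodf_neq0/(_ i isT) //.
rewrite /num_pos_eigenvalues /num_neg_eigenvalues !(permP eigE) !count_map.
rewrite -[RHS](size_enum_ord n) -(count_predC (fun i => 0 < D 0 i)).
rewrite -!enumT; congr (_ + _)%N; apply: eq_count => i /=.
have /mxOverP/(_ 0 i) Dr := Dreal.
by rewrite real_ltNge ?real0 // lt_def (negPf (D0 i)) // eq_sym D0.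
Qed.

Lemma gram_eq0C m1 m2 n (J : 'M[C]_n) (A : 'M_(m1, n)) (B : 'M_(m2, n)) :
  J \is hermsymmx -> A *m J *m B^t* = 0 -> B *m J *m A^t* = 0.
Proof.
move=> /hermP Jh /(congr1 (fun M => M^t* )).
by rewrite !adj_mul trmxCK Jh trmx0 map_mx0 mulmxA.
Qed.

(** The rows of [B] lie in the radical of the form on the span of [B0] and [B], so every term
    involving [D] or [D'] vanishes. It serves both the signature bound and the isotropy of the
    reduced polynomial. *)
Lemma gram_mod_isotropic m1 m2 r k n (J : 'M[C]_n) (B : 'M_(k, n)) (B0 : 'M_(r, n))
    (A : 'M_(m1, r)) (D : 'M_(m1, k)) (A' : 'M_(m2, r)) (D' : 'M_(m2, k)) :
  J \is hermsymmx -> B *m J *m B^t* = 0 -> B0 *m J *m B^t* = 0 ->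
  (A *m B0 + D *m B) *m J *m (A' *m B0 + D' *m B)^t* =
  A *m (B0 *m J *m B0^t* ) *m A'^t*.
Proof.
move=> Jh BB B0B; have BB0 := gram_eq0C Jh B0B.
rewrite linearD map_mxD /= !adj_mul !mulmxDl !mulmxDr.
rewrite !mulmxA -!(mulmxA D) -!(mulmxA A) BB B0B BB0.
by rewrite !(mul0mx, mulmx0, addr0).
Qed.

(** The rows of [S *m B0] and of [B] together span a space of dimension [s + k] on which the form is
    nonnegative, to be compared with the negative space [N]. *)
Lemma isotropic_pos_index m k n (J : 'M[C]_n) (N : 'M_(m, n))
    (B : 'M_(k, n)) d0 (B0 : 'M_(d0, n)) :
  (forall y, y != 0 -> herm_form J (y *m N) < 0) ->
  J \is hermsymmx ->
  B *m J *m B^t* = 0 -> B0 *m J *m B^t* = 0 -> row_free (col_mx B0 B) ->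
  forall s (S : 'M_(s, d0)) (D : 'rV_s), (forall i, 0 < D 0 i) ->
  S *m (B0 *m J *m B0^t* ) *m S^t* = diag_mx D -> (s + k + m <= n)%N.
Proof.
move=> Nneg Jh BB B0B Efree s S D D0 SD.
have formE (u : 'rV_d0) b :
    herm_form J (u *m B0 + b *m B) = herm_form (B0 *m J *m B0^t* ) u.
  by rewrite /herm_form gram_mod_isotropic // !mulmxA.
have SBfree : row_free (col_mx (S *m B0) B).
  apply: inj_row_free => v; rewrite -(hsubmxK v) mul_row_col mulmxA => vE.
  have : row_mx (lsubmx v *m S) (rsubmx v) *m col_mx B0 B = 0.
    by rewrite mul_row_col.
  move/eqP; rewrite mulmx_free_eq0 // => /eqP/(congr1 (fun M => (lsubmx M, rsubmx M))).
  rewrite row_mxKl row_mxKr !linear0 => -[aS ->].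
  suff -> : lsubmx v = 0 by rewrite row_mx0.
  (* Freeness of [S] is not assumed: a vector killed by [S] has form value zero for the positive
     diagonal [D], hence is zero. *)
  apply: (sum_scaled_norm_eq0 D0); rewrite -herm_form_diag -SD -herm_form_mull aS.
  by rewrite /herm_form !mul0mx mxE.
apply: nonneg_neg_dim SBfree _ Nneg => x.
rewrite -(hsubmxK x) mul_row_col mulmxA formE herm_form_mull SD herm_form_diag.
exact: sum_scaled_norm_ge0.
Qed.
End Inertia.

(** * Limits at infinity and leading row coefficients *)

Section Limits.
Variable R : realType.
Local Notation C := R[i].
Local Open Scope classical_set_scope.

Global Instance complex_infty_filter : ProperFilter (complex_infty R).
Proof.
apply: filter_from_proper; last first.
  move=> M _; exists (`|M| + 1)%:C => /=.
  rewrite normc_def /= expr0n addr0 sqrtr_sqr ltcR ger0_norm ?addr_ge0 //.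
  by rewrite (le_lt_trans (ler_norm M)) // ltrDl.
apply: filter_from_filter; first by exists 0.
move=> M N _ _; exists (Num.max M N) => // z /= zMN; split.
  by apply: le_lt_trans zMN; rewrite lecR le_max lexx.
by apply: le_lt_trans zMN; rewrite lecR le_max lexx orbT.
Qed.

Lemma cvg_inv_complex_infty : (z^-1 : C^o) @[z --> complex_infty R] --> (0 : C^o).
Proof.
(* The filter is indexed by real radii; a positive [e] in [C] is real, so the real part of its
   inverse is the inverse itself. *)
apply/cvgr0Pnorm_lt => e e0; exists (complex.Re e^-1) => // z /=.
rewrite RRe_real; last by rewrite ger0_real // invr_ge0 ltW.
move=> ze; rewrite normfV invf_plt ?posrE //; apply: lt_trans ze.
by rewrite invr_gt0.
Qed.

Lemma near_complex_infty_neq0 : \forall z \near complex_infty R, z != 0.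
Proof. by exists 0 => // z /=; rewrite normr_gt0. Qed.

Lemma cvg_invX_complex_infty n :
  (z ^- n.+1 : C^o) @[z --> complex_infty R] --> (0 : C^o).
Proof.
elim: n => [|n IH]; first exact: cvg_inv_complex_infty.
rewrite -[0](mulr0 (0 : C^o)).
have : (fun z : C => (z ^- n.+2 : C^o)) = (fun z => (z^-1 : C^o) * z ^- n.+1).
  by apply/funext => z; rewrite exprS invfM.
move=> ->; exact: cvgM cvg_inv_complex_infty IH.
Qed.

(** Induction on the polynomial: the scaled value of [q * 'X + c] at exponent [m.+1] is that of [q]
    at exponent [m] plus [z ^- m.+1 * c], which tends to 0. If [m] exceeds the degree, the limit is
    the zero coefficient. *)
Lemma cvg_scaled_horner (q : {poly C}) m : (size q <= m.+1)%N ->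
  (z ^- m * q.[z] : C^o) @[z --> complex_infty R] --> (q`_m : C^o).
Proof.
elim/poly_ind: q m => [|q c IH] m.
  move=> _; rewrite coef0; under eq_fun do rewrite horner0 mulr0.
  exact: cvg_cst.
rewrite size_MXaddC; case: m => [|m].
  case: ifP => [/andP[/eqP-> _] _|_]; last first.
    rewrite ltnS leqn0 size_poly_eq0 => /eqP->.
    rewrite mul0r add0r coefC /=; under eq_fun do rewrite hornerC expr0 invr1 mul1r.
    exact: cvg_cst.
  rewrite mul0r add0r coefC /=; under eq_fun do rewrite hornerC expr0 invr1 mul1r.
  exact: cvg_cst.
move=> sq; rewrite coefD coefMX coefC /= addr0.
have {}sq : (size q <= m.+1)%N by case: ifP sq => // /andP[/eqP->]; rewrite size_poly0.
rewrite -[q`_m]addr0.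
have h : (z ^- m * q.[z] + z ^- m.+1 * c : C^o) @[z --> complex_infty R]
    --> (q`_m + 0 * c : C^o).
  apply: cvgD; first exact: IH.
  by apply: cvgM; [exact: cvg_invX_complex_infty|exact: cvg_cst].
rewrite mul0r in h; apply: cvg_trans h; apply: near_eq_cvg.
near=> z.
have z0 : z != 0 by near: z; exact: near_complex_infty_neq0.
rewrite hornerMXaddC mulrDr; congr (_ + _).
by rewrite exprS invfM [q.[z] * z]mulrC mulrACA mulVf ?mul1r.
Unshelve. all: by end_near. Qed.

Lemma cvg_mx_entries T (F : set_system T) (FF : Filter F) m n
    (f : T -> 'M[C^o]_(m, n)) (L : 'M[C^o]_(m, n)) :
  (forall i j, f x i j @[x --> F] --> L i j) -> f x @[x --> F] --> L.
Proof.
move=> fL; apply/cvg_mx_entourageP => A entA.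
have h i j : \forall x \near F, (L i j, f x i j) \in A.
  have /cvg_entourageP/(_ A entA) := fL i j.
  by move=> Lf; near=> x; rewrite inE; near: x; exact: Lf.
have := filter_forall FF (fun i => filter_forall FF (h i)).
by apply: filterS => x fx i j; exact: fx.
Unshelve. all: by end_near. Qed.

(** Taking coefficients at prescribed indices, instead of leading coefficients or a limit, makes
    this linear in [P]. *)
Definition lead_coef_rows m n (mu : 'I_m -> nat) (P : 'M[{poly C}]_(m, n)) :
  'M[C]_(m, n) := \matrix_(i, j) (P i j)`_(mu i).

Lemma row_scaled_limit_lead m n (mu : 'I_m -> nat) (P : 'M[{poly C}]_(m, n)) :
  (forall i j, (size (P i j) <= (mu i).+1)%N) ->
  row_scaled_limit mu P (lead_coef_rows mu P).
Proof.
move=> sP; apply: cvg_mx_entries => i j.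
rewrite /lead_coef_rows mxE; under eq_fun do rewrite mul_diag_mx !mxE.
exact: cvg_scaled_horner.
Qed.

(** Limits are unique in a Hausdorff space; this converts the rank condition at infinity into one on
    coefficients. *)
Lemma row_scaled_limit_unique m n (mu : 'I_m -> nat) (P : 'M[{poly C}]_(m, n)) L :
  (forall i j, (size (P i j) <= (mu i).+1)%N) ->
  row_scaled_limit mu P L -> L = lead_coef_rows mu P.
Proof.
move=> /row_scaled_limit_lead Plim PL.
have h : hausdorff_space (matrix C^o m n) := @norm_hausdorff _ _.
exact: (cvg_unique h PL Plim).
Qed.
End Limits.

(** * Orthogonal completion, signature bounds and decomposition of annihilated rows *)

Section Reduction.
Variable R : realType.
Local Notation C := R[i].
Local Notation polymx A := (map_mx (@polyC C) A).

Lemma poly_eval_inj (p q : {poly C}) : (forall z, p.[z] = q.[z]) -> p = q.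
Proof.
move=> pq; apply/eqP; rewrite -subr_eq0; apply/eqP.
(* In characteristic zero the natural numbers give [size (p - q)] distinct roots, more than a
   nonzero difference can have. *)
apply: (@roots_geq_poly_eq0 _ _ [seq i%:R | i <- iota 0 (size (p - q)%R)]).
- by apply/allP => z _; rewrite /root hornerD hornerN pq subrr.
- by rewrite map_inj_uniq ?iota_uniq //; apply: mulrIn; exact: oner_neq0.
- by rewrite size_map size_iota.
Qed.

Lemma mxeval_inj m n (P P' : 'M[{poly C}]_(m, n)) :
  (forall z, mxeval P z = mxeval P' z) -> P = P'.
Proof.
move=> PP'; apply/matrixP => i j; apply: poly_eval_inj => z.
by have /matrixP/(_ i j) := PP' z; rewrite !mxE.
Qed.

Lemma mxevalM m n p (P : 'M[{poly C}]_(m, n)) (S : 'M_(n, p)) z :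
  mxeval (P *m S) z = mxeval P z *m mxeval S z.
Proof. exact: map_mxM. Qed.

Lemma mxeval_const m n (A : 'M[C]_(m, n)) z : mxeval (polymx A) z = A.
Proof. by apply/matrixP => i j; rewrite !mxE /horner_eval hornerC. Qed.

Lemma mxrank_adj m n (A : 'M[C]_(m, n)) : \rank (A^t* ) = \rank A.
Proof. by rewrite mxrank_map mxrank_tr. Qed.

Lemma mxrank_mul_adj m n (J : 'M[C]_n) (A : 'M_(m, n)) :
  J \in unitmx -> \rank (J *m A^t* ) = \rank A.
Proof.
move=> Ju; rewrite -mxrank_tr trmx_mul mxrankMfree ?mxrank_tr ?mxrank_adj //.
by rewrite row_free_unit unitmx_tr.
Qed.

Lemma row_base_of_rank (F : fieldType) m n r (A : 'M[F]_(m, n)) :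
  \rank A = r -> exists A0 : 'M_(r, n), (A0 :=: A)%MS.
Proof. by move<-; exists (row_base A); exact: eq_row_base. Qed.

Lemma row_free_col_mxr (F : fieldType) m1 m2 n (A : 'M[F]_(m1, n)) (B : 'M_(m2, n)) :
  row_free (col_mx A B) -> row_free B.
Proof.
move=> ABfree; apply: inj_row_free => v vB.
have /eqP : row_mx 0 v *m col_mx A B = 0 by rewrite mul_row_col vB mul0mx addr0.
rewrite mulmx_free_eq0 // => /eqP/(congr1 rsubmx).
by rewrite row_mxKr linear0.
Qed.

(** The orthogonal [V] of [B] has dimension [n - k = r + k] and contains [B] by isotropy, so [B0]
    can be a basis of a complement of [B] in [V]. *)
Lemma orthogonal_completion k n r (J : 'M[C]_n) (B : 'M_(k, n)) :
  J \in unitmx -> row_free B -> B *m J *m B^t* = 0 -> (r + k + k = n)%N ->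
  exists B0 : 'M[C]_(r, n), row_free (col_mx B0 B) /\
    forall m (X : 'M_(m, n)), (X <= col_mx B0 B)%MS = (X *m J *m B^t* == 0).
Proof.
move=> Ju Bfree BB rE; pose V := kermx (J *m B^t* ).
have VE m (X : 'M_(m, n)) : (X <= V)%MS = (X *m J *m B^t* == 0).
  by rewrite -mulmxA; apply/sub_kermxP/eqP.
have Vrank : \rank V = (r + k)%N.
  by rewrite mxrank_ker mxrank_mul_adj // (eqP Bfree) -rE addnK.
have BV : (B <= V)%MS by rewrite VE BB.
have [B0 B0E] : exists B0 : 'M_(r, n), (B0 :=: V :\: B)%MS.
  have capE : \rank (V :&: B)%MS = k.
    by rewrite (capmx_idPr BV) (eqP Bfree).
  apply: row_base_of_rank; apply/eqP; rewrite -(eqn_add2l k) -{1}capE.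
  by rewrite mxrank_cap_compl Vrank addnC.
have EV : (col_mx B0 B :=: V)%MS.
  apply: eqmx_trans (addsmx_diff_cap_eq V B).
  apply: eqmx_trans (eqmx_sym (addsmxE _ _)) _.
  apply: adds_eqmx => //.
  by apply: eqmx_sym; apply/capmx_idPr.
exists B0; split=> [|m X]; last by rewrite EV VE.
by rewrite /row_free EV Vrank.
Qed.

(** The orthogonal of the span of [B0] and [B] has dimension [n - (r + k) = k] and contains [B],
    hence equals its row space. A vector [v] killed by the Gram matrix puts [v *m B0] in that
    orthogonal, and independence gives [v = 0]. *)
Lemma gram_unit k r n (J : 'M[C]_n) (B : 'M_(k, n)) (B0 : 'M_(r, n)) :
  J \is hermsymmx -> J \in unitmx -> (r + k + k = n)%N ->
  row_free (col_mx B0 B) -> B *m J *m B^t* = 0 -> B0 *m J *m B^t* = 0 ->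
  B0 *m J *m B0^t* \in unitmx.
Proof.
move=> Jh Ju rE Efree BB B0B.
have BB0 := gram_eq0C Jh B0B.
have adjE : (col_mx B0 B)^t* = row_mx (B0^t* ) (B^t* ).
  by rewrite tr_col_mx map_row_mx.
have Bker : (B <= kermx (J *m (col_mx B0 B)^t* ))%MS.
  by apply/sub_kermxP; rewrite mulmxA adjE mul_mx_row BB BB0 row_mx0.
have kerB : (kermx (J *m (col_mx B0 B)^t* ) <= B)%MS.
  have Bfree := row_free_col_mxr Efree.
  rewrite -(geq_leqif (mxrank_leqif_sup Bker)) mxrank_ker mxrank_mul_adj //.
  by rewrite (eqP Efree) (eqP Bfree) -rE addKn.
rewrite -row_free_unit; apply: inj_row_free => v vG.
have /submxP[b bE] : (v *m B0 <= B)%MS.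
  apply: submx_trans kerB; apply/sub_kermxP.
  by rewrite adjE !mul_mx_row !mulmxA -!(mulmxA v) vG B0B mulmx0 row_mx0.
have /eqP : row_mx v (- b) *m col_mx B0 B = 0.
  by rewrite mul_row_col bE mulNmx subrr.
rewrite mulmx_free_eq0 // => /eqP/(congr1 lsubmx).
by rewrite row_mxKl linear0.
Qed.

(* A definite space for [Q] is carried by [Q] to one for [invmx Q]. *)
Lemma gram_mul_invmx m n (Q : 'M[C]_n) (N : 'M_(m, n)) :
  Q \is hermsymmx -> Q \in unitmx ->
  N *m Q *m invmx Q *m (N *m Q)^t* = N *m Q *m N^t*.
Proof. by move=> /hermP Qh Qu; rewrite adj_mul Qh mulmxK // mulmxA. Qed.

(** Eigenvectors of [G] of one sign, enlarged by [B], are set against the eigenvectors of [Q] of the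
    other sign, carried over to [J] through multiplication by [Q]. *)
Lemma num_eigenvalues_reduction k r n (Q : 'M[C]_n) (B : 'M_(k, n))
    (B0 : 'M_(r, n)) (J := invmx Q) (G := B0 *m J *m B0^t* ) :
  Q \is hermsymmx -> Q \in unitmx -> row_free (col_mx B0 B) ->
  B *m J *m B^t* = 0 -> B0 *m J *m B^t* = 0 ->
  (num_pos_eigenvalues G + k + num_neg_eigenvalues Q <= n)%N /\
  (num_neg_eigenvalues G + k + num_pos_eigenvalues Q <= n)%N.
Proof.
move=> Qh Qu Efree BB B0B.
have Jh : J \is hermsymmx by exact: invmx_herm.
have Gh : G \is hermsymmx.
  by apply/hermP; rewrite !adj_mul trmxCK (hermP _ Jh) mulmxA.
have neg_form m (N : 'M[C]_(m, n)) (A : 'M_n) (D : 'rV_m) :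
    N *m A *m N^t* = diag_mx (- D) -> (forall i, 0 < D 0 i) ->
    forall y, y != 0 -> herm_form A (y *m N) < 0.
  move=> NE D0 y y0; rewrite herm_form_mull NE linearN herm_formNmx oppr_lt0.
  rewrite herm_form_diag lt_def sum_scaled_norm_ge0 // andbT.
  by apply: contra y0 => /eqP/(sum_scaled_norm_eq0 D0)->.
split.
  have [S [D [D0 SD]]] := herm_compression (fun x => 0 < x) Gh.
  have [N [D' [D'0 ND]]] := herm_compression (fun x => x < 0) Qh.
  apply: (@isotropic_pos_index _ _ _ _ J (N *m Q) B _ B0 _ Jh BB B0B Efree _ S D) => //.
  apply: (neg_form _ _ _ (- D')); first by rewrite opprK gram_mul_invmx.
  by move=> i; rewrite mxE oppr_gt0.
have [S [D [D0 SD]]] := herm_compression (fun x => x < 0) Gh.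
have [N [D' [D'0 ND]]] := herm_compression (fun x => 0 < x) Qh.
(* The second bound is the first one for the form [- J], which exchanges the signs. *)
apply: (@isotropic_pos_index _ _ _ _ (- J) (N *m Q) B _ B0 _ _ _ _ Efree _ S (- D)) => //.
- apply: (neg_form _ _ _ D') => //.
  by rewrite mulmxN mulNmx gram_mul_invmx // ND linearN.
- by apply/hermP; rewrite linearN map_mxN (hermP _ Jh).
- by rewrite mulmxN mulNmx BB oppr0.
- by rewrite mulmxN mulNmx B0B oppr0.
- by move=> i; rewrite mxE oppr_gt0.
- by rewrite mulmxN mulNmx mulmxN mulNmx SD linearN.
Qed.

(** With [L] a right inverse of [col_mx B0 B], the coordinates of [T] are [T *m L]. As [L] is
    constant, they are polynomial and raise no row degree; the identity is checked pointwise in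
    [z]. *)
Lemma annihilated_decomposition m r k n (J : 'M[C]_n) (B : 'M_(k, n))
    (B0 : 'M_(r, n)) (T : 'M[{poly C}]_(m, n)) :
  row_free (col_mx B0 B) ->
  (forall m (X : 'M_(m, n)), (X <= col_mx B0 B)%MS = (X *m J *m B^t* == 0)) ->
  (forall z, mxeval T z *m J *m B^t* = 0) ->
  exists (M : 'M[C]_(n, r)) (N : 'M[C]_(n, k)),
    T = T *m polymx M *m polymx B0 + T *m polymx N *m polymx B.
Proof.
move=> /row_freeP[L EL] EJ TB.
exists (lsubmx L), (rsubmx L).
apply: mxeval_inj => z.
have /submxP[X XE] : (mxeval T z <= col_mx B0 B)%MS by rewrite EJ TB.
rewrite -!mulmxA -!map_mxM -mulmxDr -map_mxD mxevalM mxeval_const.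
by rewrite -mul_row_col hsubmxK XE -mulmxA (mulmxA _ L) EL mul1mx.
Qed.

End Reduction.

(** * Splitting off the bottom rows, with transport along [d0 + (d - d0) = d], and row degrees *)

Lemma castmx_mul_square (A : pzSemiRingType) m d n (e : m = d) (W : 'M[A]_m)
    (S : 'M_(d, n)) :
  castmx (e, e) W *m S = castmx (e, erefl n) (W *m castmx (esym e, erefl n) S).
Proof. by case: d / e S => S; rewrite !castmx_id. Qed.

Lemma det_castmx_square (A : comPzRingType) m d (e : m = d) (W : 'M[A]_m) :
  \det (castmx (e, e) W) = \det W.
Proof. by case: d / e; rewrite castmx_id. Qed.

Section RowSplitting.
Variable R : realType.
Local Notation C := R[i].
Local Notation polymx A := (map_mx (@polyC C) A).

Lemma mxeval_castmx m d n (e : m = d) (P : 'M[{poly C}]_(d, n)) z :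
  mxeval (castmx (esym e, erefl n) P) z = castmx (esym e, erefl n) (mxeval P z).
Proof. exact: map_castmx. Qed.

Lemma gram_castmx m d n (e : m = d) (J : 'M[C]_n) (A A' : 'M[C]_(d, n)) :
  A *m J *m A'^t* = 0 ->
  castmx (esym e, erefl n) A *m J *m (castmx (esym e, erefl n) A')^t* = 0.
Proof. by case: d / e A A' => A A'; rewrite !castmx_id. Qed.

Lemma row_free_castmx (F : fieldType) m d n (e : m = d) (A : 'M[F]_(d, n)) :
  row_free (castmx (esym e, erefl n) A) = row_free A.
Proof. by case: d / e A => A; rewrite castmx_id. Qed.

Lemma lead_coef_rows_castmx m d n (e : m = d) mu (P : 'M[{poly C}]_(d, n)) :
  lead_coef_rows (mu \o cast_ord e) (castmx (esym e, erefl n) P) =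
  castmx (esym e, erefl n) (lead_coef_rows mu P).
Proof.
by case: d / e mu P => mu P; apply/matrixP => i j; rewrite !castmx_id !mxE /= cast_ord_id.
Qed.

Lemma gram_col_mx m1 m2 n (J : 'M[C]_n) (A A' : 'M[C]_(m1, n)) (B B' : 'M_(m2, n)) :
  col_mx A B *m J *m (col_mx A' B')^t* =
  block_mx (A *m J *m A'^t* ) (A *m J *m B'^t* ) (B *m J *m A'^t* ) (B *m J *m B'^t* ).
Proof. by rewrite mul_col_mx tr_col_mx map_row_mx mul_col_row. Qed.

(* If [v *m A = 0] then [v] and [- v *m D] give a relation between the rows of
   [T] and [B]. *)
Lemma row_free_reduced (F : fieldType) m r k n (T : 'M[F]_(m, n)) (B : 'M_(k, n))
    (A : 'M_(m, r)) (B0 : 'M_(r, n)) (D : 'M_(m, k)) :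
  T = A *m B0 + D *m B -> row_free (col_mx T B) -> row_free A.
Proof.
move=> TE TBfree; apply: inj_row_free => v vA.
have /eqP : row_mx v (- (v *m D)) *m col_mx T B = 0.
  by rewrite mul_row_col TE mulmxDr !mulmxA vA mul0mx add0r mulNmx subrr.
rewrite mulmx_free_eq0 // => /eqP/(congr1 lsubmx).
by rewrite row_mxKl linear0.
Qed.

Lemma lead_coef_rows_mulr m n q mu (P : 'M[{poly C}]_(m, n)) (M : 'M_(n, q)) :
  lead_coef_rows mu (P *m polymx M) = lead_coef_rows mu P *m M.
Proof.
apply/matrixP => i j; rewrite !mxE coef_sum; apply: eq_bigr => l _.
by rewrite !mxE coefMC.
Qed.

Lemma lead_coef_rowsD m n mu (P S : 'M[{poly C}]_(m, n)) :
  lead_coef_rows mu (P + S) = lead_coef_rows mu P + lead_coef_rows mu S.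
Proof. by apply/matrixP => i j; rewrite !mxE coefD. Qed.

Lemma size_mul_polymx m n q (nu : 'I_m -> nat) (P : 'M[{poly C}]_(m, n)) (M : 'M_(n, q)) :
  (forall i j, (size (P i j) <= nu i)%N) ->
  forall i j, (size ((P *m polymx M) i j) <= nu i)%N.
Proof.
move=> sP i j; rewrite mxE (leq_trans (size_sum _ _ _)) //.
apply/bigmax_leqP => l _; rewrite mxE mulrC mul_polyC.
exact: leq_trans (size_scale_leq _ _) (sP i l).
Qed.

(** Independent rows are nonzero, so each row has an entry with a nonzero coefficient at index
    [mu i], and the degree bound is attained. *)
Lemma row_has_degree_lead m n (mu : 'I_m -> nat) (P : 'M[{poly C}]_(m, n)) :
  (forall i j, (size (P i j) <= (mu i).+1)%N) ->
  row_free (lead_coef_rows mu P) -> forall i, row_has_degree P i (mu i).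
Proof.
move=> sP Lfree i; apply/eqP; rewrite eqn_leq; apply/andP; split.
  by apply/bigmax_leqP => j _; exact: sP.
have [j Pij] : exists j, lead_coef_rows mu P i j != 0.
  apply/existsP; rewrite -negb_forall; apply/negP => /forallP Li0.
  have /eqP : delta_mx 0 i *m lead_coef_rows mu P = 0 :> 'rV_n.
    by rewrite -rowE; apply/rowP => j; rewrite mxE (eqP (Li0 j)) mxE.
  rewrite mulmx_free_eq0 // => /eqP/rowP/(_ i)/eqP.
  by rewrite !mxE !eqxx oner_eq0.
apply: (leq_trans _ (leq_bigmax j)); rewrite ltnNge; apply/negP => sPij.
by move: Pij; rewrite mxE nth_default ?eqxx.
Qed.

End RowSplitting.

(** * Assembly of the reduction *)

Theorem theorem2p7 (R : realType) (d0 d : nat)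
    (d0_gt0 : (0 < d0)%N) (d0_lt_d : (d0 < d)%N)
    (Q : 'M[R[i]]_(2 * d))
    (Q_herm : Q \is hermsymmx) (Q_unit : Q \in unitmx)
    (Q_pos : num_pos_eigenvalues Q = d) (Q_neg : num_neg_eigenvalues Q = d)
    (P : 'M[{poly R[i]}]_(d, 2 * d))
    (p : nat) (p_gt0 : (0 < p)%N) (P_deg : mx_has_degree P p)
    (mu : 'I_d -> nat) (P_mu : forall j : 'I_d, row_has_degree P j (mu j))
    (P_PQ : PQ Q P)
    (mu_first : forall j : 'I_d, j = 0%N :> nat -> mu j = p)
    (mu_noninc : forall j k : 'I_d, (j <= k)%N -> (mu k <= mu j)%N)
    (mu_top : forall j : 'I_d, (j < d0)%N -> (0 < mu j)%N)
    (mu_bot : forall j : 'I_d, (d0 <= j)%N -> mu j = 0%N)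
    (B : 'M[R[i]]_(d - d0, 2 * d))
    (B_bottom : map_mx polyC B = bottom_rows (ltnW d0_lt_d) P) :
  exists (W : 'M[{poly R[i]}]_d) (Phat : 'M[{poly R[i]}]_(d0, 2 * d0))
         (B0 : 'M[R[i]]_(2 * d0, 2 * d)),
    let muhat := fun j : 'I_d0 => mu (widen_ord (ltnW d0_lt_d) j) in
    let Q0 := invmx (B0 *m invmx Q *m B0^t*) in
    unimodular W /\
    W *m P = castmx (subnKC (ltnW d0_lt_d), erefl (2 * d)%N)
               (block_mx Phat 0 0 1%:M *m map_mx polyC (col_mx B0 B)) /\
    (* (i) *)
    \rank (col_mx B0 B) = (d + d0)%N /\
    (* (ii) *)
    (B *m invmx Q *m B^t* = 0 /\ B0 *m invmx Q *m B^t* = 0) /\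
    (* (iii) *)
    [/\ B0 *m invmx Q *m B0^t* \in unitmx,
        num_pos_eigenvalues (B0 *m invmx Q *m B0^t*) = d0
      & num_neg_eigenvalues (B0 *m invmx Q *m B0^t*) = d0] /\
    (* (iv) *)
    (forall z : R[i],
       mxeval Phat z *m invmx Q0 *m (mxeval Phat (z^*)%R)^t* = 0) /\
    (* (v) *)
    (forall z : R[i], \rank (mxeval Phat z) = d0) /\
    (* (vi) *)
    (exists2 Phatinf : 'M[R[i]]_(d0, 2 * d0),
       row_scaled_limit muhat Phat Phatinf & \rank Phatinf = d0) /\
    (* (vii) *)
    [/\ forall j : 'I_d0, row_has_degree Phat j (muhat j),
        forall j : 'I_d0, j = 0%N :> nat -> muhat j = p,
        forall j k : 'I_d0, (j <= k)%N -> (muhat k <= muhat j)%N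
      & forall j : 'I_d0, (1 <= muhat j)%N].
Proof.
have Jh : invmx Q \is hermsymmx by exact: invmx_herm.
have Ju : invmx Q \in unitmx by rewrite unitmx_inv.
have size_le (i : 'I_d) (j : 'I_(2 * d)) : (size (P i j) <= (mu i).+1)%N.
  by rewrite -(P_mu i) (leq_bigmax j).
have [mu' [deg' gramP rankP [Pinf Plim Pinf_rank] _]] := P_PQ.
(* [PQ] brings its own row degrees; they are determined by [P]. *)
have mu'E : mu' = mu by apply/funext => i; apply/succn_inj; rewrite -deg' P_mu.
rewrite {mu' deg'}mu'E in Plim.
rewrite {Plim}(row_scaled_limit_unique size_le Plim) in Pinf_rank.
set e := subnKC (ltnW d0_lt_d).
have [T PE] : exists T, castmx (esym e, erefl (2 * d)%N) P = col_mx T (map_mx polyC B).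
  exists (usubmx (castmx (esym e, erefl (2 * d)%N) P)).
  by rewrite B_bottom /bottom_rows vsubmxK.
pose muhat := fun j : 'I_d0 => mu (widen_ord (ltnW d0_lt_d) j).
have evalE z : castmx (esym e, erefl (2 * d)%N) (mxeval P z) = col_mx (mxeval T z) B.
  by rewrite -mxeval_castmx PE /mxeval map_col_mx -[X in col_mx _ X]/(mxeval _ z) mxeval_const.
have TBfree z : row_free (col_mx (mxeval T z) B).
  by rewrite -evalE row_free_castmx /row_free rankP.
have gramTB z : [/\ mxeval T z *m invmx Q *m (mxeval T (z^* )%R)^t* = 0,
    mxeval T z *m invmx Q *m B^t* = 0 & B *m invmx Q *m B^t* = 0].
  have := gram_castmx e (gramP z); rewrite !evalE gram_col_mx -(block_mx0 _ _ _ _ _).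
  by case/eq_block_mx.
have [_ _ BB] := gramTB 0.
have sizeT i j : (size (T i j) <= (muhat i).+1)%N.
  have -> : T i j = P (widen_ord (ltnW d0_lt_d) i) j.
    rewrite -[LHS](col_mxEu T (map_mx polyC B)) -PE castmxE /= cast_ord_id.
    by congr (P _ _); apply: val_inj.
  exact: size_le.
(* The bottom rows have degree 0, so their leading coefficients are the rows of [B] itself. *)
have leadTBfree : row_free (col_mx (lead_coef_rows muhat T) B).
  suff <- : lead_coef_rows (mu \o cast_ord e) (col_mx T (map_mx polyC B)) =
      col_mx (lead_coef_rows muhat T) B.
    by rewrite -PE lead_coef_rows_castmx row_free_castmx /row_free Pinf_rank.
  apply/matrixP => i j; rewrite mxE; case: (splitP i) => l il.
    have -> : i = lshift _ l by exact: val_inj.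
    rewrite !col_mxEu mxE /muhat /=; congr (_ `_ (mu _)); exact: val_inj.
  have -> : i = rshift _ l by exact: val_inj.
  by rewrite !col_mxEd mxE /= mu_bot /= ?leq_addr // coefC eqxx.
have Bfree := row_free_col_mxr leadTBfree.
have dimE : (2 * d0 + (d - d0) + (d - d0) = 2 * d)%N.
  by rewrite -addnA addnn -mul2n -mulnDr subnKC // ltnW.
have rankE : (2 * d0 + (d - d0) = d + d0)%N.
  by rewrite mul2n -addnn -addnA subnKC 1?addnC // ltnW.
have [B0 [Efree EJ]] := orthogonal_completion Ju Bfree BB dimE.
have B0B : B0 *m invmx Q *m B^t* = 0.
  by apply/eqP; rewrite -EJ -addsmxE addsmxSl.
have Gu := gram_unit Jh Ju dimE Efree BB B0B.
have [M [N TE]] : exists (M : 'M[R[i]]_(_, 2 * d0)) (N : 'M[R[i]]_(_, d - d0)),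
    T = T *m map_mx polyC M *m map_mx polyC B0 + T *m map_mx polyC N *m map_mx polyC B.
  by apply: annihilated_decomposition Efree EJ _ => z; have [] := gramTB z.
have TzE z : mxeval T z = mxeval (T *m map_mx polyC M) z *m B0
    + mxeval (T *m map_mx polyC N) z *m B.
  by rewrite [in LHS]TE /mxeval map_mxD; congr (_ + _);
     rewrite -[LHS]/(mxeval _ z) mxevalM mxeval_const.
have Gh : B0 *m invmx Q *m B0^t* \is hermsymmx.
  by apply/hermP; rewrite !adj_mul trmxCK (hermP _ Jh) mulmxA.
have [posG negG] := num_eigenvalues_reduction Q_herm Q_unit Efree BB B0B.
have := num_eigenvalues_unit Gh Gu.
have sizePhat := size_mul_polymx M sizeT.
have leadPhat : row_free (lead_coef_rows muhat (T *m map_mx polyC M)).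
  apply: row_free_reduced leadTBfree.
  by rewrite [in LHS]TE lead_coef_rowsD [in LHS]lead_coef_rows_mulr [X in _ + X]lead_coef_rows_mulr.
rewrite Q_pos Q_neg in posG negG; move: posG negG.
move posGE: (num_pos_eigenvalues _) => a.
move negGE: (num_neg_eigenvalues _) => b posG negG sumG.
(* The two bounds give [a <= d0] and [b <= d0], while [a + b = 2 * d0]. *)
have [aE bE] : a = d0 /\ b = d0 by clear -d0_lt_d posG negG sumG; lia.
(* Block unitriangular, hence of determinant 1; it subtracts from [T] its component along [B]. *)
exists (castmx (e, e) (block_mx 1%:M (- (T *m map_mx polyC N)) 0 1%:M)).
exists (T *m map_mx polyC M), B0 => /=.
split.
  by exists 1; rewrite ?oner_neq0 // det_castmx_square det_ublock !det1 mulr1 polyC1.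
split.
  rewrite castmx_mul_square PE; congr castmx.
  rewrite mul_block_col map_col_mx mul_block_col !mul1mx !mul0mx !add0r addr0.
  by rewrite [X in col_mx (X + _)]TE mulNmx addrK.
split.
  by move/eqP: Efree => ->; exact: rankE.
split; first by split.
split.
  by rewrite posGE negGE.
split.
  (* [Q0] is the inverse of the Gram matrix of [B0], so [invmx Q0] is that Gram matrix, and the
     isotropy of [T] modulo [B] is what remains. *)
  move=> z; rewrite invmxK.
  have [gramT _ _] := gramTB z.
  pose D w := mxeval (T *m map_mx polyC N) w.
  by rewrite -(gram_mod_isotropic _ (D z) _ (D (z^* )%R) Jh BB B0B) -!TzE gramT.
split.
  by move=> z; apply/eqP; exact: row_free_reduced (TzE z) (TBfree z).
split.
  exists (lead_coef_rows muhat (T *m map_mx polyC M)); last exact/eqP.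
  exact: row_scaled_limit_lead.
split.
- exact: row_has_degree_lead.
- by move=> j j0; apply: mu_first.
- by move=> j l jl; apply: mu_noninc.
- by move=> j; apply: mu_top => /=.
Qed.
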